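(* Let $T$ and $V$ be any two length-$n$ reflection factorizations of elements in $G_7$. Then $T$ and $V$ are Hurwitz equivalent if and only if they factor the same element, generate the same subgroup $H$ of $G_7$, and have the same multiset of conjugacy classes (of $H$).
   Context: Let $G_7$ be the subgroup of $GL_2(\mathbb{C})$ generated by $s=\begin{bmatrix}1&0\\0&-1\end{bmatrix}$, $t=\frac14\begin{bmatrix}(1+\sqrt3)+(-1+\sqrt3)i & (1+\sqrt3)+(-1+\sqrt3)i\\ (-1+\sqrt3)-(1+\sqrt3)i & (1-\sqrt3)+(1+\sqrt3)i\end{bmatrix}$ and $u=t^{\top}$; it has presentation $\langle s,t,u\mid s^2=t^3=u^3=1,\ stu=ust=tus\rangle$ and order $144$. A reflection is a linear map $\mathbb{C}^2\to\mathbb{C}^2$ whose fixed space has dimension $1$. For a group $H\le G_7$, a reflection factorization of $g\in H$ of length $n$ is a tuple $(r_1,\dots,r_n)$ of reflections lying in $H$ with $r_1\cdots r_n=g$; it generates the subgroup $\langle r_1,\dots,r_n\rangle$. The Hurwitz move $\sigma_i$ ($1\le i<n$) sends $(r_1,\dots,r_n)$ to $(r_1,\dots,r_{i-1},r_{i+1},r_{i+1}^{-1}r_ir_{i+1},r_{i+2},\dots,r_n)$. Two factorizations are Hurwitz equivalent if one is obtained from the other by a finite sequence of Hurwitz moves; the Hurwitz orbit of $T$ is the set of factorizations Hurwitz equivalent to $T$. If a factorization $T$ generates the subgroup $H$, its multiset of conjugacy classes is the multiset of $H$-conjugacy classes of its entries (each class counted with the number of entries of $T$ lying in it). *)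

(* Defs.v *)
From HB Require Import structures.
From mathcomp Require Import all_boot all_order all_algebra all_field.
From mathcomp Require Import boolp.
From Stdlib Require Import Relations.
Set Implicit Arguments. Unset Strict Implicit. Unset Printing Implicit Defensive.
Import Order.TTheory GRing.Theory Num.Theory.
Local Open Scope ring_scope.

Notation M2 := 'M[algC]_2.

Definition r3 : algC := sqrtC 3%:R.

Definition s7 : M2 := \matrix_(i < 2, j < 2)
  match val i, val j with
  | 0, 0 => 1 | 1, 1 => -1 | _, _ => 0 end.

Definition t7 : M2 := (4%:R)^-1 *: \matrix_(i < 2, j < 2)
  match val i, val j with
  | 0, 0 => (1 + r3) + (-1 + r3) * 'i
  | 0, _ => (1 + r3) + (-1 + r3) * 'i
  | _, 0 => (-1 + r3) - (1 + r3) * 'i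
  | _, _ => (1 - r3) + (1 + r3) * 'i end.

Definition u7 : M2 := t7^T.

Inductive in_gen (S : seq M2) : M2 -> Prop :=
  | gen_one : in_gen S 1
  | gen_elt x : x \in S -> in_gen S x
  | gen_mul x y : in_gen S x -> in_gen S y -> in_gen S (x * y)
  | gen_inv x : in_gen S x -> in_gen S x^-1.

Definition G7 : M2 -> Prop := in_gen [:: s7; t7; u7].

(* fixed space {v | A v = v} of the linear map v |-> A v on column vectors,
   computed as the row kernel of (A - 1)^T; reflection = fixed space of dim 1 *)
Definition is_reflection (A : M2) : Prop :=
  \rank (kermx (A - 1%:M)^T) = 1%N.

Definition refl_prod (T : seq M2) : M2 := \prod_(r <- T) r.

Definition hurwitz_move (i : nat) (T : seq M2) : seq M2 :=
  let ri := nth 0 T i in let rj := nth 0 T i.+1 in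
  set_nth 0 (set_nth 0 T i rj) i.+1 (rj^-1 * ri * rj).

Definition hurwitz_step (T V : seq M2) : Prop :=
  exists2 i, (i.+1 < size T)%N & V = hurwitz_move i T.

Definition hurwitz_equiv : seq M2 -> seq M2 -> Prop :=
  clos_refl_trans (seq M2) hurwitz_step.

Definition conj_in (H : M2 -> Prop) (x y : M2) : Prop :=
  exists2 h, H h & y = h^-1 * x * h.

Definition class_count (H : M2 -> Prop) (x : M2) (T : seq M2) : nat :=
  count (fun r => `[< conj_in H x r >]) T.

Definition refl_fact_G7 (n : nat) (T : seq M2) : Prop :=
  size T = n /\ forall r, r \in T -> G7 r /\ is_reflection r.

(* Main.v *)
Require Import Defs.
From HB Require Import structures.
From mathcomp Require Import all_boot all_order all_algebra all_field.
From mathcomp Require Import boolp.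
From Stdlib Require Import Relations.
From mathcomp Require Import ring zify.
Set Implicit Arguments. Unset Strict Implicit. Unset Printing Implicit Defensive.
Import Order.TTheory GRing.Theory Num.Theory.
Local Open Scope ring_scope.

(** A reflection of G7 is a scalar times a Hurwitz unit of order 4 or 3 in the
    binary tetrahedral group 2T, and conjugation in G7 only moves the quaternion
    part.  A factorization is therefore a word whose letters are elements of 2T
    carrying a scalar as a label.  Let H be the group generated by T.  Unless H
    is abelian, T falls into one of three families: order-2 reflections along
    several axes; both order-2 and order-3 reflections; order-3 reflections along
    several axes.  In each family the H-class of a letter is read off its label
    and its type (the axis, or the 2T-class), so the class counts say exactly that
    T and V have the same labels and types.

    Equivalence of T and V is proved by induction on the length.  Move the letters
    of V so that V ~ c V' with V' still in the family; it is enough to find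
    T ~ c T' with T' in the family.  For long T a subword of bounded length
    (3 in the first two families, 5 in the last) already suffices, whatever c is,
    and this is a finite check.  For the shorter T the product constrains c, and
    the check only concerns the c for which some V' with the right product
    exists. *)

(** * Hurwitz units *)

(* Quaternions with doubled coordinates, so that Hurwitz units are integral. *)
Definition quat := (int * int * int * int)%type.

Definition quat_mul (x y : quat) : quat :=
  let: (a, b, c, d) := x in let: (e, f, g, h) := y in
  (a * e - b * f - c * g - d * h, a * f + b * e + c * h - d * g,
   a * g - b * h + c * e + d * f, a * h + b * g - c * f + d * e).

(** Multiplying doubled coordinates gives twice the doubled product, so on products of Hurwitz units
    the halving is exact. *)
Definition quat_half (x : quat) : quat :=
  let half (m : int) : int := if m is Posz n then Posz n./2 else - Posz (`|m|./2)%N in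
  let: (a, b, c, d) := x in (half a, half b, half c, half d).

Definition quat_opp (x : quat) : quat :=
  let: (a, b, c, d) := x in (- a, - b, - c, - d).

(* The quaternion parts of the reflections: order 4 (indices 0-5), then the two classes
   of order 3 in 2T (indices 6-9 and 10-13). *)
Definition letters : seq quat :=
  [:: (0, 2, 0, 0); (0, -2, 0, 0); (0, 0, 2, 0); (0, 0, -2, 0);
      (0, 0, 0, 2); (0, 0, 0, -2);
      (-1, -1, -1, -1); (-1, -1, 1, 1); (-1, 1, -1, 1); (-1, 1, 1, -1);
      (-1, -1, -1, 1); (-1, -1, 1, -1); (-1, 1, -1, -1); (-1, 1, 1, 1)].

(** Index 14 is 1, index 15 is -1, and for [i] from 6 to 13 the opposite of unit [i] has index
    [i + 10]. *)
Definition elts : seq quat :=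
  letters ++ (2, 0, 0, 0) :: (-2, 0, 0, 0) :: map quat_opp (drop 6 letters).

Definition elt (i : nat) : quat := nth (2, 0, 0, 0) elts i.

Definition mul_table : seq (seq nat) := Eval vm_compute in
  [seq [seq index (quat_half (quat_mul x y)) elts | y <- elts] | x <- elts].

Definition muli (i j : nat) : nat := nth 0%N (nth [::] mul_table i) j.

(** Solving [j k = i j] for [k] yields the index of [j^-1 i j] without a table of inverses. *)
Definition conj_table : seq (seq nat) := Eval vm_compute in
  [seq [seq find (fun k => muli j k == muli i j) (iota 0 24) | j <- iota 0 24] | i <- iota 0 24].

Definition conji (i j : nat) : nat := nth 0%N (nth [::] conj_table i) j.

Definition prodi (s : seq nat) : nat := foldr muli 14 s.

(** * Hurwitz moves on words *)

Section Words.
Context {L : Type}.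
Implicit Types (a b : L * nat) (w : seq (L * nat)).

Definition conjl a b : L * nat := (a.1, conji a.2 b.2).

Fixpoint move (i : nat) w : seq (L * nat) :=
  match i, w with
  | 0, a :: b :: w' => b :: conjl a b :: w'
  | i'.+1, a :: w' => a :: move i' w'
  | _, _ => w
  end.

Definition act (s : seq nat) w : seq (L * nat) := foldl (fun w' i => move i w') w s.
End Words.

Fixpoint all_words (D : seq nat) (k : nat) (P : pred (seq nat)) : bool :=
  if k is k'.+1 then all (fun x => all_words D k' (fun w => P (x :: w))) D else P [::].

(* Same as [has]; call-by-value evaluation of [has] would not stop at the first
   success, because [||] is strict.  For the same reason the checks below use
   [if] instead of boolean connectives. *)
Definition lazy_has (T : Type) (p : pred T) (s : seq T) : bool := (find p s < size s)%N.

Definition has_pair (pr : rel nat) (s : seq nat) : bool :=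
  lazy_has (fun x => lazy_has (pr x) s) s.

(** Words with at most one letter count as good: they form the base of the induction, where scalar
    and product already determine the letter. *)
Definition good (pr : rel nat) (s : seq nat) : bool :=
  if (size s <= 1)%N then true else has_pair pr s.

(* Braids on [k] strands that bring the first strand back to the first place, found
   by breadth-first search in the Hurwitz orbits. *)
Definition loop_braids (k : nat) : seq (seq nat) := nth [::] [::
   [::];
   [::];
   [:: [::]; [:: 0; 0]; [:: 0; 0; 0; 0]];
   [:: [:: 0; 0]; [:: 0; 0; 0; 0]; [:: 1; 0; 0; 0; 0]; [:: 0; 0; 0; 1; 1; 0];
       [:: 0; 1; 1; 0]; [:: 1; 1; 1; 0; 0]; [:: 0; 0; 1; 1; 0; 0];
       [:: 1; 0; 0; 0; 1; 1; 0]; [:: 1; 0; 0]; [:: 0; 1; 1; 1; 1; 0]; [::]];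
   [:: [:: 0; 0]; [:: 1; 2; 2; 1; 0; 0]; [:: 0; 1; 2; 2; 1; 0]; [:: 1; 0; 0; 0; 0];
       [:: 2; 1; 0; 0]; [:: 0; 1; 1; 0]; [:: 2; 2; 1; 0; 0]; [:: 2; 1; 1; 0; 0];
       [:: 1; 0; 2; 1; 1; 0]; [:: 0; 0; 1; 1; 0; 0]; [:: 1; 0; 0]; [:: 2; 2; 1; 1; 0; 0];
       [:: 0; 0; 0; 0]; [:: 1; 1; 1; 0; 0]; [:: 0; 2; 2; 1; 1; 0]; [::]];
   [:: [:: 0; 0]; [::]; [:: 0; 1; 2; 2; 1; 0]; [:: 2; 1; 0; 0]; [:: 1; 0; 0];
       [:: 1; 1; 0; 0]; [:: 2; 1; 1; 0; 0]; [:: 2; 2; 1; 1; 0; 0]; [:: 2; 2; 1; 0; 0];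
       [:: 0; 0; 0; 0]; [:: 0; 3; 2; 1; 1; 0]; [:: 3; 2; 2; 1; 0; 0]; [:: 3; 2; 1; 0; 0];
       [:: 1; 2; 2; 1; 0; 0]; [:: 3; 2; 2; 1; 1; 0; 0]; [:: 0; 2; 1; 1; 0];
       [:: 2; 1; 0; 0; 0; 0]; [:: 3; 2; 1; 1; 0; 0]; [:: 0; 0; 2; 1; 1; 0; 0];
       [:: 0; 0; 0; 1; 2; 2; 1; 0]; [:: 1; 1; 1; 0; 0]; [:: 0; 2; 2; 1; 1; 0];
       [:: 1; 1; 0; 2; 1; 1; 0]; [:: 1; 0; 2; 2; 1; 1; 0]]]%N k.

Definition can_start_with (pr : rel nat) (xs : seq nat) (c : nat) : bool :=
  let w := zip (iota 0 (size xs)) xs in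
  lazy_has (fun s =>
    if act s w is (l, y) :: v
    then if y == c then if l == 0%N then good pr (unzip2 v) else false else false
    else false) (loop_braids (size xs)).

(** A [c] that no listed braid reaches must be excluded by the product: no good tail of the right
    types completes it. *)
Definition short_check (D : seq nat) (pr : rel nat) (tau : nat -> nat) (k : nat) : bool :=
  all_words D k (fun xs => if good pr xs then
    all (fun c => if tau c != tau (head 0%N xs) then true else
      if can_start_with pr xs c then true else all_words D k.-1 (fun v =>
         if prodi (c :: v) != prodi xs then true else
         ~~ (good pr v && (map tau v == map tau (behead xs))))) D
    else true).

(* [core] is a condition on a bounded subword [xs] of a long word, enough to move any [c] of
   the type of [head xs] to the front. *)
Definition long_check (D : seq nat) (pr : rel nat) (tau : nat -> nat) (core : pred (seq nat))
    (k : nat) : bool :=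
  all_words D k (fun xs => if core xs then
    all (fun c => if tau c != tau (head 0%N xs) then true else can_start_with pr xs c) D
    else true).

Definition noncomm (x y : nat) := conji x y != x.
Definition mixed (x y : nat) := (x < 6)%N (+) (y < 6)%N.
Definition unit_type (x : nat) : nat := ((6 <= x) + (10 <= x))%N.
(** Opposite units of order 4 have indices [2m] and [2m + 1]. *)
Definition axis (x : nat) : nat := (x./2)%N.

(** * Hurwitz equivalence of labelled words *)

Section WordTheory.
Context {L : Type}.
Implicit Types (a b : L * nat) (w v : seq (L * nat)).

Inductive word_step : seq (L * nat) -> seq (L * nat) -> Prop :=
  WordStep w a b v : word_step (w ++ a :: b :: v) (w ++ b :: conjl a b :: v).

Definition word_equiv := clos_refl_trans (seq (L * nat)) word_step.

Lemma word_equiv_trans w1 w2 w3 :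
  word_equiv w1 w2 -> word_equiv w2 w3 -> word_equiv w1 w3.
Proof. exact: rt_trans. Qed.

Lemma word_equiv_ctx u1 u2 w v :
  word_equiv w v -> word_equiv (u1 ++ w ++ u2) (u1 ++ v ++ u2).
Proof.
elim=> [_ _ [w1 a b w2] | x | x y z _ h1 _ h2].
- rewrite -!catA !cat_cons !catA -!catA !(catA u1); apply: rt_step.
  by rewrite -!catA !(catA u1); constructor.
- exact: rt_refl.
- exact: rt_trans h1 h2.
Qed.

Lemma word_equiv_cons a w v : word_equiv w v -> word_equiv (a :: w) (a :: v).
Proof. by move=> /(word_equiv_ctx [:: a] [::]); rewrite !cats0. Qed.

Lemma word_equiv_catr u w v : word_equiv w v -> word_equiv (w ++ u) (v ++ u).
Proof. exact: (word_equiv_ctx [::]). Qed.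

Lemma move_equiv i w : word_equiv w (move i w).
Proof.
elim: i w => [|i IH] [|a w] /=; try exact: rt_refl; last exact/word_equiv_cons/IH.
by case: w => [|b w]; [exact: rt_refl | exact/rt_step/(WordStep [::])].
Qed.

Lemma act_equiv s w : word_equiv w (act s w).
Proof.
elim: s w => [|i s IH] w /=; first exact: rt_refl.
exact: word_equiv_trans (move_equiv i w) (IH _).
Qed.

Lemma pull_equiv w a v :
  word_equiv (w ++ a :: v) (a :: map (conjl^~ a) w ++ v).
Proof.
elim: w => [|b w IH] /=; first exact: rt_refl.
apply: word_equiv_trans (word_equiv_cons _ IH) _.
exact/rt_step/(WordStep [::]).
Qed.

Lemma size_word_equiv w v : word_equiv w v -> size w = size v.
Proof.
elim=> [_ _ [w1 a b w2] | // | x y z _ -> _ -> //].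
by rewrite !size_cat.
Qed.

End WordTheory.

Lemma move_map (L L' : Type) (f : L -> L') i (w : seq (L * nat)) :
  let F := map (fun a => (f a.1, a.2)) in move i (F w) = F (move i w).
Proof.
elim: i w => [|i IH] [|a w] //=; last by rewrite IH.
by case: w.
Qed.

(** Moves never inspect labels, so a braid found with strand numbers as labels acts in the same way
    on scalar labels. *)
Lemma act_map (L L' : Type) (f : L -> L') s (w : seq (L * nat)) :
  let F := map (fun a => (f a.1, a.2)) in act s (F w) = F (act s w).
Proof. by elim: s w => [|i s IH] w //=; rewrite move_map IH. Qed.

Lemma lazy_hasE (T : Type) (p : pred T) s : lazy_has p s = has p s.
Proof. by rewrite /lazy_has has_find. Qed.

Lemma has_pairP (pr : rel nat) (s : seq nat) :
  reflect (exists x y, [/\ x \in s, y \in s & pr x y]) (has_pair pr s).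
Proof.
rewrite /has_pair lazy_hasE; apply: (iffP hasP).
  by case=> x xs; rewrite lazy_hasE => /hasP [y ys h]; exists x, y.
by case=> x [y [xs ys h]]; exists x => //; rewrite lazy_hasE; apply/hasP; exists y.
Qed.

Lemma goodE pr s : good pr s = (size s <= 1)%N || has_pair pr s.
Proof. by []. Qed.

Lemma all_wordsP D k (P : pred (seq nat)) (s : seq nat) :
  all_words D k P -> size s = k -> {subset s <= D} -> P s.
Proof.
elim: k P s => [|k IH] P [|x s] //= /allP h [sk] sD.
apply: (IH (fun w => P (x :: w))) => //; first exact/h/sD/mem_head.
by move=> y ys; apply: sD; rewrite inE ys orbT.
Qed.

Lemma sub_has_pair pr (s t : seq nat) :
  {subset s <= t} -> has_pair pr s -> has_pair pr t.
Proof.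
by move=> st /has_pairP [x [y [xs ys h]]]; apply/has_pairP; exists x, y; split=> //; apply: st.
Qed.

Lemma iota24_check (P : nat -> nat -> bool) :
  all (fun i => all (P i) (iota 0 24)) (iota 0 24) ->
  forall i j, (i < 24)%N -> (j < 24)%N -> P i j.
Proof. by move=> /allP h i j hi hj; apply: (allP (h i _)); rewrite mem_iota. Qed.

Lemma muli_lt i j : (i < 24)%N -> (j < 24)%N -> (muli i j < 24)%N.
Proof. by move: i j; apply: (@iota24_check (fun i j => muli i j < 24)%N); vm_compute. Qed.

Lemma conji_lt i j : (i < 24)%N -> (j < 24)%N -> (conji i j < 24)%N.
Proof. by move: i j; apply: (@iota24_check (fun i j => conji i j < 24)%N); vm_compute. Qed.

Lemma muli_conji i j : (i < 24)%N -> (j < 24)%N -> muli j (conji i j) = muli i j.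
Proof.
move=> hi hj; apply/eqP; move: i j hi hj.
by apply: (@iota24_check (fun i j => muli j (conji i j) == muli i j)); vm_compute.
Qed.

Lemma conji_letter i j : (i < 14)%N -> (j < 24)%N -> (conji i j < 14)%N.
Proof.
move=> hi hj; have hi' : (i < 24)%N := @leq_trans 14 _ 24 hi isT.
move: i j hi' hj hi.
have h := @iota24_check (fun i j => if (i < 14)%N then (conji i j < 14)%N else true).
by move=> i j hi hj hi14; have := h _ i j hi hj; rewrite hi14; apply; vm_compute.
Qed.

Section Symmetry.
Context {L : Type}.

Let is_letter (a : L * nat) := (a.2 < 14)%N.

Lemma all_letters_equiv (w v : seq (L * nat)) :
  all is_letter w -> word_equiv w v -> all is_letter v.
Proof.
move=> hw e; elim: e hw => [_ _ [w1 a b w2] | // | x y z _ h1 _ h2 h]; last exact/h2/h1.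
rewrite !all_cat /= => /and4P [-> ha hb ->]; rewrite hb /= andbT.
by rewrite /is_letter /conjl /= conji_letter // (ltn_trans hb).
Qed.

Let pair_step (p : (L * nat) * (L * nat)) := (p.2, conjl p.1 p.2).

(** Two moves at the same place conjugate a pair [(x, y)] by [x y], which stays fixed. Modulo the
    centre of 2T, [x y] has order 1, 2 or 3, so twelve moves restore the pair and eleven moves undo
    one. *)
Lemma word_equiv_sym (w v : seq (L * nat)) :
  all is_letter w -> word_equiv w v -> word_equiv v w.
Proof.
have idx12 (x y : nat) : (x < 14)%N -> (y < 14)%N ->
    iter 12 (fun p => (p.2, conji p.1 p.2)) (x, y) = (x, y).
  move=> hx hy; apply/eqP.
  have h : all (fun i => all (fun j => iter 12 (fun p => (p.2, conji p.1 p.2)) (i, j) == (i, j))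
             (iota 0 14)) (iota 0 14) by vm_compute.
  by move/allP: h => /(_ x); rewrite mem_iota => /(_ hx) /allP /(_ y); rewrite mem_iota => /(_ hy).
(* The labels are swapped at each step, hence restored after an even number of steps. *)
have iterE n (a b : L * nat) :
    ((iter n pair_step (a, b)).1.2, (iter n pair_step (a, b)).2.2) =
      iter n (fun p => (p.2, conji p.1 p.2)) (a.2, b.2) /\
    ((iter n pair_step (a, b)).1.1, (iter n pair_step (a, b)).2.1) =
      if odd n then (b.1, a.1) else (a.1, b.1).
  elim: n => [|n [e1 e2]] //; rewrite !iterS -e1 /=.
  case: (iter n pair_step _) e2 => [[? ?] [? ?]] /= [].
  by case: (odd n) => -[-> ->].
have iter12 (a b : L * nat) : is_letter a -> is_letter b ->
    iter 12 pair_step (a, b) = (a, b).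
  move=> ha hb; have [] := iterE 12 a b; rewrite idx12 //.
  move: (iter 12 pair_step (a, b)) => [[? ?] [? ?]] /= [-> ->] [-> ->].
  by case: a b {ha hb} => [? ?] [? ?].
have iter_equiv n w1 a b w2 : word_equiv (w1 ++ a :: b :: w2)
    (w1 ++ (iter n pair_step (a, b)).1 :: (iter n pair_step (a, b)).2 :: w2).
  elim: n => [|n IH]; first exact: rt_refl.
  apply: word_equiv_trans IH _; rewrite iterS; apply: rt_step.
  by case: (iter n pair_step _) => x y; constructor.
move=> hw e; elim: e hw => [_ _ [w1 a b w2] hw | x _ | x y z e1 h1 e2 h2 hx].
- have := iter_equiv 11 w1 b (conjl a b) w2.
  have -> : iter 11 pair_step (b, conjl a b) = iter 12 pair_step (a, b) by rewrite iterSr.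
  have [ha hb] : is_letter a /\ is_letter b.
    by move: hw; rewrite all_cat /= => /and4P [].
  by rewrite iter12.
- exact: rt_refl.
- exact: word_equiv_trans (h2 (all_letters_equiv hx e1)) (h1 hx).
Qed.
End Symmetry.

(** * Matrices *)

Definition quat_mx (x : quat) : M2 := let: (a, b, c, d) := x in
  \matrix_(i < 2, j < 2)
   match val i, val j with
   | 0, 0 => a%:~R + b%:~R * 'i | 0, _ => c%:~R + d%:~R * 'i
   | _, 0 => - c%:~R + d%:~R * 'i | _, _ => a%:~R - b%:~R * 'i end.

Lemma quat_mxM x y : quat_mx x * quat_mx y = quat_mx (quat_mul x y).
Proof.
case: x => [[[a b] c] d]; case: y => [[[e f] g] h].
have i2 : ('i : algC) * 'i = -1 by rewrite -expr2 sqrCi.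
by apply/matrixP => i j; rewrite !mxE !big_ord_recl big_ord0 !mxE;
  case: i j => [[|[|[]]] // ?] [[|[|[]]] // ?] /=;
  rewrite !(rmorphB, rmorphD, rmorphM) /=; ring: i2.
Qed.

(** The diagonal entries, and up to sign the others, have the form [a + b i] and [a - b i]; their
    sum and difference recover the coordinates. *)
Lemma quat_mx_inj : injective quat_mx.
Proof.
have aux (a b e f : int) : a%:~R + b%:~R * 'i = e%:~R + f%:~R * 'i :> algC ->
    a%:~R - b%:~R * 'i = e%:~R - f%:~R * 'i :> algC -> a = e /\ b = f.
  move=> h1 h2; have two : (2%:R : algC) != 0 by rewrite pnatr_eq0.
  have ha : 2%:R * a%:~R = 2%:R * e%:~R :> algC.
    transitivity (a%:~R + b%:~R * 'i + (a%:~R - b%:~R * 'i) : algC); first by ring.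
    by rewrite h1 h2; ring.
  have hb : 2%:R * 'i * b%:~R = 2%:R * 'i * f%:~R :> algC.
    transitivity (a%:~R + b%:~R * 'i - (a%:~R - b%:~R * 'i) : algC); first by ring.
    by rewrite h1 h2; ring.
  split; apply: (@intr_inj algC); first exact: mulfI ha.
  by apply: mulfI hb; rewrite mulf_neq0 ?neq0Ci.
move=> [[[a b] c] d] [[[e f] g] k] /matrixP h.
have := h 0 0; have := h 0 1; have := h 1 0; have := h 1 1; rewrite !mxE /= => h1 h2 h3 h4.
have [-> ->] := aux _ _ _ _ h4 h1.
have h2' : c%:~R - d%:~R * 'i = g%:~R - k%:~R * 'i :> algC.
  by apply: oppr_inj; rewrite opprB opprB ![_ * 'i - _]addrC.
by have [-> ->] := aux _ _ _ _ h3 h2'.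
Qed.

Lemma quat_mx1 : quat_mx (2, 0, 0, 0) = 2%:R.
Proof.
apply/matrixP => i j; rewrite !mxE.
by case: i j => [[|[|[]]] // ?] [[|[|[]]] // ?] /=; rewrite ?mul0r ?mulr0n ?oppr0 ?addr0 ?subr0.
Qed.

Lemma quat_mx_opp x : quat_mx (quat_opp x) = - quat_mx x.
Proof.
case: x => [[[a b] c] d]; apply/matrixP => i j; rewrite !mxE.
by case: i j => [[|[|[]]] // ?] [[|[|[]]] // ?] /=; rewrite !rmorphN /=; ring.
Qed.

Lemma mxtrace_quat x : \tr (quat_mx x) = 2%:R * x.1.1.1%:~R.
Proof.
by case: x => [[[a b] c] d]; rewrite /mxtrace !big_ord_recl big_ord0 !mxE /=; ring.
Qed.

Lemma elt_inj i j : (i < 24)%N -> (j < 24)%N -> elt i = elt j -> i = j.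
Proof. by move=> hi hj /eqP; rewrite nth_uniq // => /eqP. Qed.

Lemma quat_mul_elt i j : (i < 24)%N -> (j < 24)%N ->
  quat_mul (elt i) (elt j) = quat_mul (2, 0, 0, 0) (elt (muli i j)).
Proof.
move=> hi hj; apply/eqP; move: i j hi hj.
apply: (@iota24_check (fun i j => quat_mul (elt i) (elt j) ==
  quat_mul (2, 0, 0, 0) (elt (muli i j)))).
by vm_compute.
Qed.

(** Dividing by 2 undoes the doubling of coordinates: this is the scalar times the unit quaternion
    in its usual 2x2 complex form. *)
Definition phi (a : algC * nat) : M2 := (a.1 / 2%:R) *: quat_mx (elt a.2).

Lemma phiM a b : (a.2 < 24)%N -> (b.2 < 24)%N ->
  phi a * phi b = phi (a.1 * b.1, muli a.2 b.2).
Proof.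
move=> ha hb; rewrite /phi /= -scalerAl -scalerAr scalerA quat_mxM quat_mul_elt //.
rewrite -quat_mxM quat_mx1 mulr_natl -scaler_nat scalerA.
by congr (_ *: _); field.
Qed.

Lemma phi1 : phi (1, 14%N) = 1.
Proof.
rewrite /phi (_ : elt (1 : algC, 14%N).2 = (2, 0, 0, 0)) // quat_mx1.
by rewrite /= -scaler_nat scalerA mul1r mulVf ?scale1r ?pnatr_eq0.
Qed.

Lemma phi_unit a : a.1 != 0 -> (a.2 < 24)%N -> phi a \is a GRing.unit.
Proof.
case: a => z i /= hz hi.
have : has (fun j => (muli i j == 14) && (muli j i == 14))%N (iota 0 24).
  have /allP h : all (fun i => has (fun j => (muli i j == 14) && (muli j i == 14))%N (iota 0 24))
    (iota 0 24) by vm_compute.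
  by apply: h; rewrite mem_iota.
case/hasP => j; rewrite mem_iota => hj /andP [/eqP e1 /eqP e2].
apply/unitrP; exists (phi (z^-1, j)).
by rewrite !phiM //= e1 e2 mulVf // mulfV // phi1.
Qed.

Lemma phi_conj a b : b.1 != 0 -> (a.2 < 24)%N -> (b.2 < 24)%N ->
  phi (conjl a b) = (phi b)^-1 * phi a * phi b.
Proof.
move=> hb0 ha hb; apply: (mulrI (phi_unit hb0 hb)).
rewrite !mulrA mulrV ?phi_unit // mul1r !phiM //= ?conji_lt //.
by rewrite muli_conji // mulrC.
Qed.

(** The common scalar matters: [(z, i)] and [(- z, - i)] name the same matrix. *)
Lemma phi_inj_label z i j : z != 0 -> (i < 24)%N -> (j < 24)%N ->
  phi (z, i) = phi (z, j) -> i = j.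
Proof.
move=> hz hi hj /= e; apply: elt_inj => //; apply: quat_mx_inj.
apply: (scalerI _ e).
by rewrite mulf_neq0 // invr_eq0 pnatr_eq0.
Qed.

Definition eval_word (w : seq (algC * nat)) : M2 := refl_prod (map phi w).

Lemma prodi_lt s : all (fun i => i < 24)%N s -> (prodi s < 24)%N.
Proof. by elim: s => //= i s IH /andP [hi hs]; apply: muli_lt => //; apply: IH. Qed.

Lemma eval_wordE w : all (fun i => i < 24)%N (unzip2 w) ->
  eval_word w = phi (\prod_(z <- unzip1 w) z, prodi (unzip2 w)).
Proof.
elim: w => [|a w IH] /=; first by rewrite /eval_word /refl_prod !big_nil phi1.
case/andP=> ha hw; rewrite /eval_word /refl_prod /= !big_cons.
by rewrite [\prod_(_ <- map _ _) _]IH // phiM //=; exact: prodi_lt.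
Qed.

(** * Invariants of Hurwitz equivalence for matrix factorizations *)

Lemma hurwitz_stepP (T V : seq M2) : hurwitz_step T V <->
  exists A a b B, T = A ++ a :: b :: B /\ V = A ++ b :: b^-1 * a * b :: B.
Proof.
have moveE A a b B : hurwitz_move (size A) (A ++ a :: b :: B) = A ++ b :: b^-1 * a * b :: B.
  rewrite /hurwitz_move !nth_cat ltnn subnn ltnNge leqnSn /= subSnn /=.
  by elim: A => [|x A IH] //=; rewrite IH.
split=> [[i hi ->] | [A [a [b [B [-> ->]]]]]]; last first.
  by exists (size A); rewrite ?moveE // size_cat /= -addn2 leq_add2l.
exists (take i T), (nth 0 T i), (nth 0 T i.+1), (drop i.+2 T).
have e : T = take i T ++ nth 0 T i :: nth 0 T i.+1 :: drop i.+2 T.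
  by rewrite -{1}(cat_take_drop i T) (drop_nth 0) ?(drop_nth 0 (n := i.+1)) // ltnW.
split=> //; rewrite -moveE -e size_takel //.
exact: ltnW (ltnW hi).
Qed.

Lemma in_gen_sub (S S' : seq M2) x :
  (forall y, y \in S -> in_gen S' y) -> in_gen S x -> in_gen S' x.
Proof.
move=> h; elim=> [|y /h //|y z _ hy _ hz|y _ hy]; first exact: gen_one.
  exact: gen_mul.
exact: gen_inv.
Qed.

Lemma in_gen_unit (S : seq M2) x :
  {in S, forall y, y \is a GRing.unit} -> in_gen S x -> x \is a GRing.unit.
Proof.
move=> h; elim=> [|y /h //|y z _ hy _ hz|y _ hy]; first exact: unitr1.
  by rewrite unitrMl.
by rewrite unitrV.
Qed.

Lemma in_gen_conj (S : seq M2) a b : b \is a GRing.unit ->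
  a \in S -> b \in S -> in_gen S (b^-1 * a * b).
Proof.
move=> ub aS bS; apply: gen_mul; last exact: gen_elt.
by apply: gen_mul; [apply: gen_inv | ]; exact: gen_elt.
Qed.

Lemma conj_in_trans (S : seq M2) x y z : {in S, forall y, y \is a GRing.unit} ->
  conj_in (in_gen S) x y -> conj_in (in_gen S) y z -> conj_in (in_gen S) x z.
Proof.
move=> u [h gh ->] [k gk ->]; exists (h * k); first exact: gen_mul.
by rewrite invrM ?(in_gen_unit u) // !mulrA.
Qed.

Lemma conj_in_sym (S : seq M2) x y : {in S, forall y, y \is a GRing.unit} ->
  conj_in (in_gen S) x y -> conj_in (in_gen S) y x.
Proof.
move=> u [h gh ->]; exists h^-1; first exact: gen_inv.
have uh := in_gen_unit u gh.
by rewrite invrK !mulrA mulrV // mul1r mulrK.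
Qed.

(** Only [a] is replaced, by its conjugate under [b]. Since [b] is an entry both before and after
    the move, the generated group stays the same, and the conjugation takes place inside it. *)
Lemma hurwitz_step_inv (T V : seq M2) :
  {in T, forall y, y \is a GRing.unit} -> hurwitz_step T V ->
  [/\ {in V, forall y, y \is a GRing.unit}, refl_prod T = refl_prod V,
      in_gen T = in_gen V & forall x, class_count (in_gen T) x T = class_count (in_gen T) x V].
Proof.
move=> u /hurwitz_stepP [A [a [b [B [eT eV]]]]].
have aT : a \in T by rewrite eT mem_cat !inE eqxx !orbT.
have bT : b \in T by rewrite eT mem_cat !inE eqxx !orbT.
have ua := u _ aT; have ub := u _ bT.
have bV : b \in V by rewrite eV mem_cat !inE eqxx !orbT.
have cV : b^-1 * a * b \in V by rewrite eV mem_cat !inE eqxx !orbT.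
have uV : {in V, forall y, y \is a GRing.unit}.
  move=> y; rewrite eV mem_cat !inE => /or4P [h | /eqP -> // | /eqP -> | h].
  - by apply: u; rewrite eT mem_cat h.
  - by rewrite !(unitrMl, unitrV, unitrMr).
  - by apply: u; rewrite eT mem_cat !inE h !orbT.
split=> //.
- rewrite eT eV /refl_prod !big_cat /= !big_cons; congr (_ * _).
  by rewrite !mulrA mulrV // mul1r.
- apply/funext => x; apply/propext; split; apply: in_gen_sub => y; last first.
    rewrite eV mem_cat !inE => /or4P [h | /eqP -> | /eqP -> | h].
    + by apply: gen_elt; rewrite eT mem_cat h.
    + exact: gen_elt.
    + exact: in_gen_conj.
    + by apply: gen_elt; rewrite eT mem_cat !inE h !orbT.
  rewrite eT mem_cat !inE => /or4P [h | /eqP -> | /eqP -> | h].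
  + by apply: gen_elt; rewrite eV mem_cat h.
  + have -> : a = b * (b^-1 * a * b) * b^-1 by rewrite !mulrA mulrV // mul1r mulrK.
    by apply: gen_mul; [apply: gen_mul | apply: gen_inv]; exact: gen_elt.
  + exact: gen_elt.
  + by apply: gen_elt; rewrite eV mem_cat !inE h !orbT.
- move=> x; rewrite /class_count eT eV !count_cat /= -eT; congr (_ + _)%N.
  rewrite addnCA; congr (_ + (_ + _))%N; congr (nat_of_bool _).
  have c : conj_in (in_gen T) a (b^-1 * a * b) by exists b => //; exact: gen_elt.
  apply/asboolP/asboolP => h; first exact: conj_in_trans h c.
  exact: conj_in_trans h (conj_in_sym u c).
Qed.

Lemma hurwitz_equiv_inv (T V : seq M2) :
  {in T, forall y, y \is a GRing.unit} -> hurwitz_equiv T V ->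
  [/\ {in V, forall y, y \is a GRing.unit}, refl_prod T = refl_prod V,
      in_gen T = in_gen V & forall x, class_count (in_gen T) x T = class_count (in_gen T) x V].
Proof.
move=> u e; elim: e u => [T' V' s u | // | T1 T2 T3 _ h1 _ h2 u]; first exact: hurwitz_step_inv.
have [u2 p2 g2 c2] := h1 u; have [u3 p3 g3 c3] := h2 u2.
by split=> // [||x]; rewrite ?p2 ?g2 // -g2 c2 g2 c3.
Qed.

Definition nz_letters (w : seq (algC * nat)) := all (fun a => (a.1 != 0) && (a.2 < 24)%N) w.

Lemma nz_letters_equiv w v : nz_letters w -> word_equiv w v -> nz_letters v.
Proof.
move=> hw e; elim: e hw => [_ _ [w1 a b w2] | // | x y z _ h1 _ h2 h]; last exact/h2/h1.
rewrite /nz_letters !all_cat /= => /and4P [-> /andP [ha1 ha2] hb ->]; rewrite hb ha1 /= andbT.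
by case/andP: hb => _ hb; rewrite conji_lt.
Qed.

Lemma hurwitz_equiv_phi w v : nz_letters w -> word_equiv w v ->
  hurwitz_equiv (map phi w) (map phi v).
Proof.
move=> hw e; elim: e hw => [_ _ [w1 a b w2] | x _ | x y z e1 h1 _ h2 h].
- rewrite /nz_letters all_cat /= => /and4P [_ /andP [ha1 ha2] /andP [hb1 hb2] _].
  apply: rt_step; apply/hurwitz_stepP; exists (map phi w1), (phi a), (phi b), (map phi w2).
  by rewrite !map_cat /= phi_conj.
- exact: rt_refl.
- exact: rt_trans (h1 h) (h2 (nz_letters_equiv h e1)).
Qed.

(** * Letters, types and pairs *)

Definition class_ok (D : seq nat) (tau : nat -> nat) : bool :=
  all (fun x => (x < 14)%N && all (fun y => (conji x y \in D) && (tau (conji x y) == tau x)) D) D.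

(** The final disjunction lets a related pair [x], [y] survive the move of [z] past [x]: some
    related pair remains among [conji x z], [y] and [z]. *)
Definition pair_ok (D : seq nat) (pr : rel nat) : bool :=
  all (fun x => ~~ pr x x && all (fun y => pr x y ==> (pr y x &&
    all (fun z => pr (conji x z) (conji y z) &&
      [|| pr (conji x z) y, pr z y | pr z (conji x z)]) D)) D) D.

Lemma conjii x : (x < 24)%N -> conji x x = x.
Proof.
move=> hx; have /allP h : all (fun x => conji x x == x) (iota 0 24) by vm_compute.
by apply/eqP/h; rewrite mem_iota.
Qed.

Section Classes.
Context (D : seq nat) (tau : nat -> nat) (okD : class_ok D tau).
Implicit Types (a b : algC * nat) (w v : seq (algC * nat)).

Definition lab a : algC * nat := (a.1, tau a.2).

Definition okw w := all (fun a => (a.1 != 0) && (a.2 \in D)) w.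

Lemma D_lt x : x \in D -> (x < 14)%N.
Proof. by move=> xD; have /andP [] := allP okD x xD. Qed.

Lemma D_lt24 x : x \in D -> (x < 24)%N.
Proof. by move=> /D_lt h; exact: leq_trans h _. Qed.

Lemma conji_D x y : x \in D -> y \in D -> conji x y \in D.
Proof. by move=> xD yD; have /andP [_ /allP /(_ y yD) /andP []] := allP okD x xD. Qed.

Lemma tau_conji x y : x \in D -> y \in D -> tau (conji x y) = tau x.
Proof. by move=> xD yD; have /andP [_ /allP /(_ y yD) /andP [_ /eqP]] := allP okD x xD. Qed.

Lemma okw_nz w : okw w -> nz_letters w.
Proof. by apply: sub_all => a /andP [-> /D_lt24 ->]. Qed.

Lemma okw_letters w : okw w -> all (fun a => a.2 < 14)%N w.
Proof. by apply: sub_all => a /andP [_ /D_lt ->]. Qed.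

Lemma okw_D w : okw w -> {subset unzip2 w <= D}.
Proof. by move=> /allP h _ /mapP [a /h /andP [_ aD] ->]. Qed.

Lemma okw_inv w v : okw w -> word_equiv w v -> okw v /\ perm_eq (map lab w) (map lab v).
Proof.
move=> ok e; elim: e ok => [_ _ [w1 a b w2] | // | x y z _ h1 _ h2 /h1 [/h2 [ok p2] p1]].
  rewrite /okw !all_cat /= => /and4P [-> /andP [ha1 ha2] /andP [hb1 hb2] ->].
  rewrite hb1 hb2 ha1 conji_D //; split=> //.
  rewrite !map_cat perm_cat2l /= [lab (conjl _ _)]/lab /= tau_conji //.
  by apply/permPl/(perm_catCA [:: _] [:: _]).
by split=> //; exact: perm_trans p1 p2.
Qed.

Lemma eval_equiv w v : okw w -> word_equiv w v -> eval_word w = eval_word v.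
Proof.
move=> /okw_nz ok /(hurwitz_equiv_phi ok) /hurwitz_equiv_inv [] // _ /mapP [a aw ->].
by have /andP [h1 h2] := allP ok a aw; exact: phi_unit.
Qed.

(** Labels survive conjugation, so pulling forward a letter with each prescribed label in turn
    realizes any order of the labels. *)
Lemma word_rearrange w s : okw w -> perm_eq (map lab w) s ->
  exists2 v, word_equiv w v & map lab v = s.
Proof.
elim: s w => [|l s IH] w ok p.
  by exists w; [exact: rt_refl | apply/eqP; rewrite -size_eq0 (perm_size p)].
have : l \in map lab w by rewrite (perm_mem p) mem_head.
case/mapP=> a aw el; case/splitPr: aw ok p => w1 w2 ok p.
have e := pull_equiv w1 a w2.
have [ok' p'] := okw_inv ok e.
have ok2 : okw (map (conjl^~ a) w1 ++ w2) by case/andP: ok'.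
have [|v ev lv] := IH _ ok2.
  by rewrite -(perm_cons l) -(permPr p) perm_sym (permPl p') /= el.
exists (a :: v); first exact: word_equiv_trans e (word_equiv_cons _ ev).
by rewrite /= lv el.
Qed.

Section Pairs.
Context (pr : rel nat) (okpr : pair_ok D pr).

Lemma pr_irr x : x \in D -> pr x x = false.
Proof. by move=> xD; have /andP [/negbTE] := allP okpr x xD. Qed.

Lemma pr_spec x y z : x \in D -> y \in D -> z \in D -> pr x y ->
  [/\ pr y x, pr (conji x z) (conji y z)
    & [|| pr (conji x z) y, pr z y | pr z (conji x z)]].
Proof.
move=> xD yD zD h; have /andP [_ /allP /(_ y yD)] := allP okpr x xD.
by rewrite h /= => /andP [-> /allP /(_ z zD) /andP [-> ->]].
Qed.

(** A move loses at most the letter [a]. A pair avoiding [a] persists; a pair using it is replaced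
    through the disjunction in [pair_ok], with [z] the letter [b]. *)
Lemma has_pair_equiv w v : okw w -> word_equiv w v ->
  has_pair pr (unzip2 w) -> has_pair pr (unzip2 v).
Proof.
move=> ok e; elim: e ok => [_ _ [w1 a b w2] ok | // | x y z e1 h1 _ h2 ok h]; last first.
  by apply: h2; [case: (okw_inv ok e1) | exact: h1].
have hD := okw_D ok.
set s := unzip2 _ in hD *; set t := unzip2 _.
have aD : a.2 \in D by apply: hD; apply: (map_f snd); rewrite mem_cat !inE eqxx !orbT.
have bD : b.2 \in D by apply: hD; apply: (map_f snd); rewrite mem_cat !inE eqxx !orbT.
have bt : b.2 \in t by apply: (map_f snd); rewrite mem_cat !inE eqxx !orbT.
have ct : conji a.2 b.2 \in t.
  by apply: (@map_f _ _ snd _ (conjl a b)); rewrite mem_cat !inE eqxx !orbT.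
have st y : y \in s -> y = a.2 \/ y \in t.
  rewrite /s /t /unzip2 !map_cat /= !mem_cat !inE.
  by case/or4P => [->|/eqP ->|->|->]; rewrite ?orbT; [right|left|right|right].
have main y : y \in s -> pr a.2 y -> has_pair pr t.
  move=> ys h; case: (st y ys) => [e | yt]; first by rewrite e pr_irr in h.
  have [_ _] := pr_spec aD (hD _ ys) bD h.
  case/or3P=> h'; apply/has_pairP; first by exists (conji a.2 b.2), y.
    by exists b.2, y.
  by exists b.2, (conji a.2 b.2).
case/has_pairP=> x [y [xs ys h]].
case: (st x xs) (st y ys) => [ex _ | xt [ey | yt]].
- by apply: (main y); rewrite -?ex.
- by apply: (main x) => //; rewrite -ey; have [] := pr_spec (hD _ xs) (hD _ ys) bD h.
- by apply/has_pairP; exists x, y.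
Qed.

Lemma pair_front w : okw w -> has_pair pr (unzip2 w) ->
  exists a b v, word_equiv w (a :: b :: v) /\ pr a.2 b.2.
Proof.
move=> ok /has_pairP [x [y [/mapP [a aw ->] {x} yw h]]].
case/splitPr: aw ok yw => w1 w2 ok yw.
have hD := okw_D ok.
have aD : a.2 \in D by apply: hD; apply: (map_f snd); rewrite mem_cat !inE eqxx !orbT.
have yD := hD _ yw.
(* A partner standing left of [a] gets conjugated by [a] when [a] is pulled. Conjugating the whole
   pair by [a] fixes [a], so the two remain related. *)
have [b bR hb] : exists2 b, b \in map (conjl^~ a) w1 ++ w2 & pr a.2 b.2.
  move: yw; rewrite /unzip2 map_cat mem_cat /= inE => /or3P [|/eqP e|].
  - case/mapP=> b bw e; exists (conjl b a); first by rewrite mem_cat (map_f (conjl^~ a)) .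
    by have [_ h' _] := pr_spec aD yD aD h; rewrite conjii ?D_lt24 // e in h'.
  - by rewrite e pr_irr in h.
  - by case/mapP=> b bw e; exists b; rewrite -?e // mem_cat bw orbT.
have e := pull_equiv w1 a w2; case/splitPr: bR e => R1 R2 e.
exists a, b, (map (conjl^~ b) R1 ++ R2); split=> //.
apply: word_equiv_trans e _; apply: word_equiv_cons; exact: pull_equiv.
Qed.

End Pairs.
End Classes.

(** * Induction on the length *)

Section WordTheorem.
Context (D : seq nat) (tau : nat -> nat) (pr : rel nat) (core : pred (seq nat)) (K : nat).
Context (okD : class_ok D tau) (okpr : pair_ok D pr) (K3 : (3 <= K)%N).
Implicit Types (a b : algC * nat) (w v : seq (algC * nat)).

Let ok := okw D.
Let lb := lab tau.

Context (small : forall k, (1 < k < K)%N -> short_check D pr tau k).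
Context (big : long_check D pr tau core K).
Context (core_front : forall a w v, ok (a :: w) -> has_pair pr (unzip2 (a :: w)) ->
  ok v -> good pr (unzip2 v) -> map lb w = map lb v -> (K <= size (a :: w))%N ->
  exists2 w', word_equiv w w' & core (take K (unzip2 (a :: w')))).

Lemma pair_good w : (1 < size w)%N -> good pr (unzip2 w) = has_pair pr (unzip2 w).
Proof. by rewrite goodE size_map ltnNge => /negbTE ->. Qed.

(** The search labels letters by strand numbers; reading number [i] as the [i]-th scalar of [w]
    turns its outcome into an equivalence of [w]. *)
Lemma can_start_with_equiv a w c : can_start_with pr (unzip2 w) c ->
  exists2 v, word_equiv w (((head a w).1, c) :: v) & good pr (unzip2 v).
Proof.
rewrite /can_start_with lazy_hasE => /hasP [s _]; set z := zip _ _ => h.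
have zE : map (fun e => ((nth a w e.1).1, e.2)) z = w.
  apply: (@eq_from_nth _ a); first by rewrite size_map size_zip size_iota size_map minnn.
  move=> i; rewrite size_map size_zip size_iota !size_map minnn => hi.
  rewrite (nth_map (0%N, 0%N)) ?size_zip ?size_iota ?size_map ?minnn //.
  rewrite nth_zip ?size_iota ?size_map // nth_iota ?size_map // add0n.
  by rewrite /unzip2 (nth_map a) //=; case: (nth a w i).
move: h; have := act_map (fun i => (nth a w i).1) s z; rewrite /= zE.
have := act_equiv s w => e eq; move: e; rewrite eq; case: (act s z) => [//|[l y] v] /= e.
case: (y =P c) => // <-; case: (l =P 0%N) => // le g; rewrite le nth0 in e.
by exists (map (fun e => ((nth a w e.1).1, e.2)) v) => //; rewrite /unzip2 -map_comp.
Qed.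

(** With at least three letters, a related pair is brought to the front and the third letter pulled
    past it: the pair is only conjugated and lies in the tail. *)
Lemma peel_good v : (1 < size v)%N -> ok v -> good pr (unzip2 v) ->
  exists a u, word_equiv v (a :: u) /\ good pr (unzip2 u).
Proof.
move=> hs okv; rewrite pair_good // => /(pair_front okD okpr okv) [a [b [[|r u] [e h]]]].
  by exists a, [:: b].
have [okv' _] := okw_inv okD okv e.
exists r, (map (conjl^~ r) [:: a; b] ++ u); split.
  exact: word_equiv_trans e (pull_equiv [:: a; b] r u).
rewrite goodE; apply/orP; right; apply/has_pairP.
exists (conji a.2 r.2), (conji b.2 r.2); rewrite !inE !eqxx orbT; split=> //.
have /and4P [/andP [_ aD] /andP [_ bD] /andP [_ rD] _] := okv'.
by have [] := pr_spec okpr aD bD rD h.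
Qed.

Lemma good_equiv w v : ok w -> word_equiv w v -> good pr (unzip2 w) -> good pr (unzip2 v).
Proof.
move=> okW e; rewrite !goodE !size_map (size_word_equiv e); case: leqP => //= _.
exact: (has_pair_equiv okD okpr okW e).
Qed.

Lemma eval_cons_inj a w v : ok (a :: w) -> eval_word (a :: w) = eval_word (a :: v) ->
  eval_word w = eval_word v.
Proof.
rewrite /eval_word /refl_prod /= !big_cons => /andP [/andP [h0 hD] _]; apply: mulrI.
exact: phi_unit h0 (D_lt24 okD hD).
Qed.

Lemma word_equiv_of_labels w v : ok w -> ok v -> good pr (unzip2 w) -> good pr (unzip2 v) ->
  perm_eq (map lb w) (map lb v) -> eval_word w = eval_word v -> word_equiv w v.
Proof.
have [n] := ubnP (size w); elim: n => // n IH in w v *; rewrite ltnS => hn.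
move=> okW okV gw gv p ev.
have sz : size v = size w by rewrite -(size_map lb w) (perm_size p) size_map.
case: (ltnP 1 (size w)) => [h1 | ]; last first.
  case: w v sz p ev okW okV {gw gv hn} => [|[z x] [|? ?]] [|[z' x'] [|? ?]] //= _.
    by move=> *; exact: rt_refl.
  (* Single letters: equal labels give equal scalars, and the product then determines the unit. *)
  move=> p; have /= := perm_mem p (z', tau x'); rewrite !inE eqxx => /eqP [-> _].
  rewrite /eval_word /refl_prod /= !big_cons !big_nil !mulr1 => e.
  move=> /andP [/andP /= [h0 h1] _] /andP [/andP /= [h0' h1'] _] _.
  rewrite (phi_inj_label _ _ _ e) ?(D_lt24 okD) //; exact: rt_refl.
have h1v : (1 < size v)%N by rewrite sz.
(* After [v] becomes [a :: u], [w] is put into the same order of labels. Its first letter [b] then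
   has the scalar and type of [a], and only the unit may differ. *)
have [a [u [eu gu]]] := peel_good h1v okV gv.
have [okau pu] := okw_inv okD okV eu.
have [w1 e1 l1] := word_rearrange okD okW (perm_trans p pu).
have [ok1 _] := okw_inv okD okW e1.
have gw1 := good_equiv okW e1 gw.
have ev1 : eval_word w1 = eval_word (a :: u).
  by rewrite -(eval_equiv okD okW e1) -(eval_equiv okD okV eu).
have szu : size w1 = size w by rewrite (size_word_equiv e1).
case: w1 => [|b w1] in e1 l1 ok1 gw1 ev1 szu *; first by move: h1; rewrite -szu.
have l0 : map lb (b :: w1) = map lb (a :: u) := l1.
case: l1 => l1 lt lw.
have szw : size u = size w1 by rewrite -(size_map lb u) -lw size_map.
(* Cancelling the common first letter [a] leaves [t] and [u], shorter good words with the same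
   labels and product. *)
suff [t et gt] : exists2 t, word_equiv (b :: w1) (a :: t) & good pr (unzip2 t).
  have [okat pt] := okw_inv okD ok1 et.
  have evt : eval_word t = eval_word u.
    by apply: (@eval_cons_inj a) => //; rewrite -(eval_equiv okD ok1 et).
  apply: word_equiv_trans e1 _; apply: (word_equiv_trans et).
  apply: word_equiv_trans _ (word_equiv_sym (okw_letters okD okV) eu).
  apply: word_equiv_cons; apply: IH => //.
  - by apply: leq_trans hn; rewrite -szu (size_word_equiv et).
  - by case/andP: okat.
  - by case/andP: okau.
  - by rewrite -(perm_cons (lb a)) -(permPl pt) [map _ (b :: w1)]l0.
have aD : a.2 \in D by case/andP: okau => /andP [].
have hb : a = (b.1, a.2) by rewrite l1; case: (a).
case: (ltnP (size w) K) => [hK | hK].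
  have /small hsm : (1 < size w < K)%N by rewrite h1.
  have := all_wordsP hsm (s := unzip2 (b :: w1)); rewrite size_map szu => /(_ erefl (okw_D ok1)).
  rewrite gw1 => /allP /(_ _ aD); rewrite lt eqxx /=.
  case: ifP => [hh _ | _].
  by have [t et gt] := can_start_with_equiv b (w := b :: w1) hh; exists t; rewrite // hb.
  (* When no braid is found, the check denies any good tail with the right types and product; [u] is
     one, a contradiction. *)
  move/all_wordsP => /(_ (unzip2 u)) hsu.
  have h : {subset unzip2 u <= D} by apply: okw_D; case/andP: okau.
  have hp : prodi (a.2 :: unzip2 u) = prodi (unzip2 (b :: w1)).
    have lt24 x : ok x -> all (fun i => i < 24)%N (unzip2 x).
      by move=> okx; apply/allP => i /(okw_D okx) /(D_lt24 okD).
    have lt24' x : ok x -> (prodi (unzip2 x) < 24)%N by move=> okx; apply/prodi_lt/lt24.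
    (* Equal labels make the products of scalars agree, so equality of matrices reduces to equality
       in 2T. *)
    have lw1 : unzip1 (b :: w1) = unzip1 (a :: u).
      by have := congr1 (map fst) l0; rewrite -!map_comp.
    move: ev1; rewrite !eval_wordE ?lt24 // lw1 => /esym /phi_inj_label.
    apply; rewrite ?(lt24' (_ :: _)) //.
    rewrite prodf_seq_neq0; apply/allP => z /mapP [c cu ->] /=.
    by have /andP [] := allP okau c cu.
  have : if prodi (a.2 :: unzip2 u) != prodi (unzip2 (b :: w1)) then true else
    ~~ (good pr (unzip2 u) && (map tau (unzip2 u) == map tau (unzip2 w1))).
    by apply: hsu => //; rewrite size_map szw -szu.
  rewrite hp eqxx gu /=; case/eqP.
  by have := congr1 (map snd) lw; rewrite -!map_comp.
(* Long words: the braid acts on the first [K] letters only, and the others are carried along on the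
   right. *)
have gp : has_pair pr (unzip2 (b :: w1)) by rewrite -pair_good ?szu.
have oku : ok u by case/andP: okau.
have [|w2 e2 c2] := core_front ok1 gp oku gu lw; first by rewrite szu.
have sz2 : size w2 = size w1 by rewrite (size_word_equiv e2).
have [ok2 _] := okw_inv okD ok1 (word_equiv_cons b e2).
have sK : size (take K (unzip2 (b :: w2))) = K.
  by rewrite size_takel // size_map /= sz2 -/(size (b :: w1)) szu.
have := all_wordsP big sK; rewrite c2.
have -> : take K (unzip2 (b :: w2)) = unzip2 (b :: take K.-1 w2).
  by rewrite -map_take; case: (K) K3.
have sD : {subset unzip2 (b :: take K.-1 w2) <= D}.
  by apply: okw_D; move: ok2 => /= /andP [-> /allP h]; apply/allP => c /mem_take; exact: h.
move=> /(_ sD) /allP /(_ _ aD); rewrite [head _ _]/= lt eqxx /= => hh.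
have [t et gt] := can_start_with_equiv b (w := b :: take K.-1 w2) hh.
exists (t ++ drop K.-1 w2).
  apply: word_equiv_trans (word_equiv_cons b e2) _.
  rewrite -{1}(cat_take_drop K.-1 w2) -cat_cons.
  by rewrite -cat_cons hb; exact: word_equiv_catr.
(* [t] has [K - 1] letters, at least two, so its goodness provides an actual pair, which persists
   when the remaining letters are appended. *)
have st : (1 < size t)%N.
  have := size_word_equiv et; rewrite /= size_takel => [[<-]|].
    by move: K3; case: (K) => [|[|[|k]]].
  by move: hK; rewrite sz2 -szu /=; case: (K).
rewrite pair_good in gt => //; rewrite goodE; apply/orP; right.
by apply: sub_has_pair gt => x; rewrite /unzip2 map_cat mem_cat => ->.
Qed.

End WordTheorem.

(** * Elements and reflections of G7 *)

Lemma phi_neg z i : (i < 24)%N -> phi (z, i) = phi (- z, muli 15 i).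
Proof.
move=> hi.
have e : phi (- 1, 15%N) = 1.
  rewrite -phi1 /phi (_ : elt (-1 : algC, 15%N).2 = quat_opp (elt 14)) // quat_mx_opp.
  by rewrite scalerN -scaleNr mulNr opprK.
by rewrite -[LHS]mul1r -e phiM //= mulN1r.
Qed.

Lemma phi_scalar z : phi (z, 14%N) = z%:M.
Proof.
rewrite /phi (_ : elt (z, 14%N).2 = (2, 0, 0, 0)) // quat_mx1 /= -scaler_nat scalerA.
by rewrite divfK ?pnatr_eq0 // scalemx1.
Qed.

Lemma s7E : s7 = phi (- 'i, 0%N).
Proof.
have i2 : ('i : algC) * 'i = -1 by rewrite -expr2 sqrCi.
apply/matrixP => i j; rewrite !mxE.
by case: i j => [[|[|[]]] // ?] [[|[|[]]] // ?] /=; field: i2.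
Qed.

(** A primitive sixth root of unity. *)
Definition zt : algC := (1 + r3 * 'i) / 2%:R.

Lemma r3_sqr : r3 * r3 = 3%:R.
Proof. by rewrite -expr2 sqrtCK. Qed.

Lemma zt_exp : zt ^+ 12 = 1.
Proof.
have i2 : ('i : algC) * 'i = -1 by rewrite -expr2 sqrCi.
have h : zt ^+ 3 = -1 by rewrite /zt; field: i2 r3_sqr.
by rewrite (exprM zt 3 4) h -signr_odd.
Qed.

Lemma t7E : t7 = phi (zt, 18%N).
Proof.
have i2 : ('i : algC) * 'i = -1 by rewrite -expr2 sqrCi.
apply/matrixP => i j; rewrite !mxE /zt.
by case: i j => [[|[|[]]] // ?] [[|[|[]]] // ?] /=; field: i2.
Qed.

Lemma u7E : u7 = phi (zt, 23%N).
Proof.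
rewrite /u7 t7E; apply/matrixP => i j; rewrite !mxE.
by case: i j => [[|[|[]]] // ?] [[|[|[]]] // ?] /=; congr (_ * _); ring.
Qed.

(** The generators have scalars of order 4 ([s7]) and 6 ([t7], [u7]), whence the exponent 12. *)
Lemma G7_phi x : G7 x -> exists2 a, x = phi a & (a.1 ^+ 12 == 1) && (a.2 < 24)%N.
Proof.
elim=> [|y|y z _ [a -> /andP [ha1 ha2]] _ [b -> /andP [hb1 hb2]]|y _ [a -> /andP [ha1 ha2]]].
- by exists (1, 14%N); rewrite ?phi1 //= expr1n eqxx.
- rewrite !inE => /or3P [] /eqP ->.
  + by exists (- 'i, 0%N); rewrite ?s7E //= (exprM _ 2 6) sqrrN sqrCi -signr_odd eqxx.
  + by exists (zt, 18%N); rewrite ?t7E //= zt_exp eqxx.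
  + by exists (zt, 23%N); rewrite ?u7E //= zt_exp eqxx.
- exists (a.1 * b.1, muli a.2 b.2); rewrite ?phiM //=.
  by rewrite exprMn (eqP ha1) (eqP hb1) mulr1 eqxx muli_lt.
have a0 : a.1 != 0 by apply: contraTneq ha1 => ->; rewrite expr0n /= eq_sym oner_eq0.
have : has (fun j => muli a.2 j == 14%N) (iota 0 24).
  have /allP h : all (fun i => has (fun j => muli i j == 14) (iota 0 24))%N (iota 0 24).
    by vm_compute.
  by apply: h; rewrite mem_iota.
case/hasP => j; rewrite mem_iota => hj /eqP e.
exists (a.1^-1, j); last by rewrite /= exprVn (eqP ha1) invr1 eqxx.
apply: (mulrI (phi_unit a0 ha2)).
by rewrite mulrV ?phi_unit // phiM //= mulfV // e phi1.
Qed.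

Lemma phiX z i n : (i < 24)%N -> phi (z, i) ^+ n = phi (z ^+ n, iter n (muli i) 14).
Proof.
move=> hi; suff h : (iter n (muli i) 14 < 24)%N /\
    phi (z, i) ^+ n = phi (z ^+ n, iter n (muli i) 14) by case: h.
elim: n => [|n [h1 h2]]; first by rewrite !expr0 phi1.
by rewrite !exprS iterS h2 phiM //= muli_lt.
Qed.

Lemma G7_exp12 x : G7 x -> x ^+ 12 = 1.
Proof.
case/G7_phi=> -[z i] -> /= /andP [/eqP hz hi]; rewrite phiX // hz.
have /allP h : all (fun i => iter 12 (muli i) 14 == 14)%N (iota 0 24) by vm_compute.
by rewrite (eqP (h i _)) ?mem_iota // phi1.
Qed.

(* For [a.2 < 6] the pairs [(z, i)] and [(- z, - i)] name the same matrix, so the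
   scalar of a reflection of order 2 is normalised. *)
Definition refl_letter (a : algC * nat) : bool :=
  [&& a.1 != 0, (a.2 < 14)%N & (a.2 < 6)%N ==> (a.1 == 'i)].

Lemma reflection_singular A : is_reflection A -> A - 1 \isn't a GRing.unit /\ A != 1.
Proof.
rewrite /is_reflection mxrank_ker mxrank_tr => h; split.
  by apply/negP=> u; move: h; rewrite (eqP (_ : row_full (A - 1%:M))) // row_full_unit.
by apply: contra_eqN h => /eqP ->; rewrite subrr mxrank0.
Qed.

Lemma G7_reflection A : G7 A -> is_reflection A -> exists2 a, A = phi a & refl_letter a.
Proof.
move=> /G7_phi [[z i] -> /= /andP [hz hi]] /reflection_singular [sing n1].
have z0 : z != 0 by apply: contraTneq hz => ->; rewrite expr0n /= eq_sym oner_eq0.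
(* A scalar matrix with eigenvalue 1 is the identity, which is no reflection. *)
have not_scalar c : phi (z, i) != c%:M.
  apply/eqP => e; move: sing n1; rewrite e.
  have -> : c%:M - 1 = (c - 1)%:M :> M2 by rewrite raddfB.
  rewrite -[_ \is a _]/(_ \in unitmx) unitmxE det_scalar unitfE expf_eq0 /= negbK subr_eq0.
  by move=> /eqP ->; rewrite eqxx.
have lt6 j : (j < 6)%N -> muli j j = 15.
  by case: j => [|[|[|[|[|[]]]]]].
have [h6|h6] := ltnP i 6.
  (* A unit of order 4 squares to -1, so the matrix squares to the scalar [- z ^+ 2]; eigenvalue 1
     forces this to be 1. *)
  have zi : z ^+ 2 == -1.
    apply: contraNT sing => hz2; have c0 : - z ^+ 2 - 1 != 0.
      by rewrite subr_eq0 eqr_oppLR.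
    have e : (phi (z, i) - 1) * (phi (z, i) + 1) = (- z ^+ 2 - 1)%:M.
      rewrite -subr_sqr_1 expr2 phiM //= lt6 // phi_neg // phi_scalar -expr2.
      by rewrite [in RHS]raddfB.
    have u : (- z ^+ 2 - 1)%:M \is a @GRing.unit M2.
      by rewrite -[_ \is a _]/(_ \in unitmx) unitmxE det_scalar unitfE expf_neq0.
    have comm : GRing.comm (phi (z, i) - 1) (phi (z, i) + 1).
      apply: commrD (commr1 _); apply: commr_sym.
      exact: commrB (commr_refl _) (commr1 _).
    by have := unitrM_comm comm; rewrite e u => /esym /andP [].
  move: zi; rewrite -sqrCi eqf_sqr => /orP [/eqP e | /eqP e].
    by exists (z, i); rewrite // /refl_letter /= z0 (ltn_trans h6) //= e eqxx implybT.
  exists ('i, muli 15 i); first by rewrite phi_neg // e opprK.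
  rewrite /refl_letter /= neq0Ci eqxx implybT andbT.
  by case: i h6 {hi not_scalar e sing n1} => [|[|[|[|[|[]]]]]].
have [h14|h14] := ltnP i 14.
  by exists (z, i); rewrite // /refl_letter /= z0 h14 ltnNge h6.
have [h16|h16] := ltnP i 16.
  have [e|e] : i = 14 \/ i = 15 by lia.
    by have := not_scalar z; rewrite e phi_scalar eqxx.
  by have := not_scalar (- z); rewrite e phi_neg // -phi_scalar eqxx.
(* Indices from 16 on are opposites of the order-3 letters; the sign moves into the scalar. *)
exists (- z, muli 15 i); first exact: phi_neg.
rewrite /refl_letter /= oppr_eq0 z0 /=.
have /allP h : all (fun i => (6 <= muli 15 i < 14)%N) (iota 16 8) by vm_compute.
have /h /andP [h1 h2] : i \in iota 16 8 by rewrite mem_iota h16.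
by rewrite h2 ltnNge h1.
Qed.

Lemma phi_trace a : \tr (phi a) = a.1 * (elt a.2).1.1.1%:~R.
Proof. by rewrite /phi mxtraceZ mxtrace_quat; field. Qed.

Lemma elt_trace i : (i < 14)%N -> (elt i).1.1.1 = if (i < 6)%N then 0 else -1.
Proof.
move=> hi.
have /allP h : all (fun i => (elt i).1.1.1 == if (i < 6)%N then 0 else -1) (iota 0 14).
  by vm_compute.
by apply/eqP/h; rewrite mem_iota.
Qed.

(** The trace is 0 on letters of order 4 and [- z] on those of order 3. It separates the two kinds
    and recovers the scalar of the second; that of the first is normalised. *)
Lemma phi_inj a b : refl_letter a -> refl_letter b -> phi a = phi b -> a = b.
Proof.
case: a b => [z i] [z' j] /and3P [/= z0 hi si] /and3P [/= z0' hj sj] e.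
have ez : z = z'.
  have := congr1 (fun A : M2 => \tr A) e; rewrite !phi_trace /= !elt_trace //.
  move: si sj; case: (i < 6)%N; case: (j < 6)%N => /=.
  - by move=> /eqP -> /eqP ->.
  - by move=> _ _ /esym /eqP; rewrite mulr0 mulrN1 oppr_eq0 (negbTE z0').
  - by move=> _ _ /eqP; rewrite mulr0 mulrN1 oppr_eq0 (negbTE z0).
  - by move=> _ _; rewrite !mulrN1 => /oppr_inj.
rewrite -ez in e *; congr (_, _).
by apply: (phi_inj_label z0 _ _ e); [exact: leq_trans hi _ | exact: leq_trans hj _].
Qed.

Lemma reflection_word n T : refl_fact_G7 n T ->
  exists2 w, T = map phi w & all refl_letter w.
Proof.
case=> _; elim: T => [|A T IH] h; first by exists [::].
have [gA rA] := h A (mem_head _ _).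
have [a -> ha] := G7_reflection gA rA.
have [|w -> hw] := IH; first by move=> r rT; apply: h; rewrite inE rT orbT.
by exists (a :: w) => //=; rewrite ha.
Qed.

(** * Class counts *)

Lemma conji_lt6 i j : (i < 14)%N -> (j < 24)%N -> (conji i j < 6)%N = (i < 6)%N.
Proof.
move=> hi hj; have hi' : (i < 24)%N := @leq_trans 14 _ 24 hi isT.
pose P i j := (conji i j < 6)%N == (i < 6)%N.
have hP : all (fun i => all (P i) (iota 0 24)) (iota 0 24) by vm_compute.
exact: eqP (iota24_check hP hi' hj).
Qed.

Lemma refl_letter_lt24 a : refl_letter a -> (a.2 < 24)%N.
Proof. by case/and3P=> _ h _; exact: leq_trans h _. Qed.

Lemma refl_conj a b : refl_letter a -> (b.2 < 24)%N -> refl_letter (conjl a b).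
Proof.
by case/and3P=> h1 h2 h3 hb; rewrite /refl_letter /= h1 conji_letter // conji_lt6 // h3.
Qed.

Lemma refl_letter_unit w : all refl_letter w -> {in map phi w, forall y, y \is a GRing.unit}.
Proof.
move=> /allP h _ /mapP [a /h ha ->]; apply: phi_unit (refl_letter_lt24 ha).
by case/and3P: ha.
Qed.

(** Four rounds of conjugation by a related pair [p], [q] exhaust the letters of the type of [c] in
    each family, as the evaluations of [trans_ok] confirm. *)
Definition reach (p q c : nat) : seq nat :=
  iter 4 (fun s => undup (s ++ map (conji^~ p) s ++ map (conji^~ q) s)) [:: c].

Definition trans_ok (D : seq nat) (tau : nat -> nat) (pr : rel nat) : bool :=
  all (fun p => all (fun q => if pr p q then
    all (fun c => all (fun d => if tau c == tau d then d \in reach p q c else true) D) D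
    else true) D) D.

(** A single related pair in [w] already acts transitively by conjugation on the letters of each
    type. *)
Lemma trans_conj_in D tau pr (w : seq (algC * nat)) a b :
  class_ok D tau -> trans_ok D tau pr -> okw D w -> has_pair pr (unzip2 w) ->
  a.2 \in D -> b.2 \in D -> lab tau a = lab tau b ->
  conj_in (in_gen (map phi w)) (phi a) (phi b).
Proof.
move=> okD okt okW /has_pairP [p [q [pw qw hpq]]] aD bD [e1 e2].
have pD := okw_D okW pw; have qD := okw_D okW qw.
have := allP (allP okt p pD) q qD; rewrite hpq => /allP /(_ _ aD) /allP /(_ _ bD).
rewrite e2 eqxx /reach.
have aux n d :
    d \in iter n (fun s => undup (s ++ map (conji^~ p) s ++ map (conji^~ q) s)) [:: a.2] ->
    d \in D /\ conj_in (in_gen (map phi w)) (phi a) (phi (a.1, d)).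
  have u : {in map phi w, forall y, y \is a GRing.unit}.
    move=> _ /mapP [c cw ->]; have /andP [c1 c2] := allP okW c cw.
    exact: phi_unit c1 (D_lt24 okD c2).
  have gen r d' : r \in unzip2 w -> d' \in D ->
      conj_in (in_gen (map phi w)) (phi (a.1, d')) (phi (a.1, conji d' r)).
    case/mapP=> c cw -> dD; have /andP [c1 c2] := allP okW c cw.
    exists (phi c); first by apply: gen_elt; exact: map_f.
    by rewrite -phi_conj ?(D_lt24 okD).
  elim: n d => [|n IH] d.
    rewrite inE => /eqP ->; split=> //; exists 1; first exact: gen_one.
    by rewrite invr1 mul1r mulr1; case: (a).
  rewrite iterS mem_undup !mem_cat.
  case/or3P=> [/IH // | /mapP [d' /IH [dD hc] ->] | /mapP [d' /IH [dD hc] ->]].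
    by split; [ exact: (conji_D okD) | exact: conj_in_trans hc (gen _ _ pw dD)].
  by split; [ exact: (conji_D okD) | exact: conj_in_trans hc (gen _ _ qw dD)].
by move=> /aux [_]; rewrite e1; case: (b).
Qed.

Section ClassCounts.
Context (D : seq nat) (tau : nat -> nat) (okD : class_ok D tau) (w v : seq (algC * nat)).
Context (rw : all refl_letter w) (rv : all refl_letter v) (okW : okw D w).
Context (G7w : forall x, x \in map phi w -> G7 x).
Let H := in_gen (map phi w).
Context (same_class : forall a b, a.2 \in D -> b.2 \in D -> lab tau a = lab tau b ->
  conj_in H (phi a) (phi b)).

Let unit_w := refl_letter_unit rw.

(** Conjugation by a generator keeps labels, and this passes to products; an inverse is an eleventh
    power, by [G7_exp12]. *)
Lemma conj_in_lab a x : refl_letter a -> a.2 \in D -> conj_in H (phi a) x ->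
  exists b, [/\ x = phi b, refl_letter b, b.2 \in D & lab tau b = lab tau a].
Proof.
move=> ra aD [h gh ->].
pose P g := forall a, refl_letter a -> a.2 \in D ->
  exists b, [/\ g^-1 * phi a * g = phi b, refl_letter b, b.2 \in D & lab tau b = lab tau a].
suff : P h by apply.
have Pmul g k : g \is a GRing.unit -> k \is a GRing.unit -> P g -> P k -> P (g * k).
  move=> ug uk hg hk b rb bD; have [c [ec rc cD lc]] := hg b rb bD.
  have [d [ed rd dD ld]] := hk c rc cD; exists d; split=> //; last by rewrite ld.
  by rewrite -ed -ec invrM // !mulrA.
have P1 : P 1.
  by move=> b rb bD; exists b; rewrite invr1 mul1r mulr1.
elim: gh => [|x0 /mapP [b bw ->]|x0 y0 gx hx gy hy|x0 gx hx] //.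
- move=> c rc cD; have /andP [b1 b2] := allP okW b bw.
  exists (conjl c b); rewrite phi_conj ?(D_lt24 okD) //; split=> //.
  + by apply: refl_conj (D_lt24 okD b2).
  +  exact: (conji_D okD) cD b2.
  + by rewrite /lab /= (tau_conji okD).
- by apply: Pmul => //; exact: in_gen_unit gx || exact: in_gen_unit gy.
have ux : x0 \is a GRing.unit := in_gen_unit unit_w gx.
have Gx : G7 x0 by apply: in_gen_sub gx.
have -> : x0^-1 = x0 ^+ 11.
  by apply: (mulrI ux); rewrite mulrV // -exprS G7_exp12.
elim: 11%N => [|n IH]; first by rewrite expr0.
by rewrite exprS; apply: Pmul => //; rewrite unitrX.
Qed.

Lemma class_countE u a : all refl_letter u -> okw D u -> refl_letter a -> a.2 \in D ->
  class_count H (phi a) (map phi u) = count (fun b => lab tau b == lab tau a) u.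
Proof.
move=> /allP ru /allP okU ra aD; rewrite /class_count count_map.
apply: eq_in_count => b bu /=; have /andP [_ bD] := okU b bu.
apply/asboolP/eqP => [/(conj_in_lab ra aD) [c [e rc _ <-]] | e]; last exact: same_class.
by rewrite (phi_inj (ru b bu) rc e).
Qed.

Context (same_gen : in_gen (map phi v) = H).
Context (same_count : forall x, H x -> class_count H x (map phi w) = class_count H x (map phi v)).

(** Each entry of [v] lies in a class that occurs in [w], hence is a letter over [D]; class counts
    are then label counts on both sides. *)
Lemma same_labels : okw D v /\ perm_eq (map (lab tau) w) (map (lab tau) v).
Proof.
have okV : okw D v.
  apply/allP => b bv; have rb := allP rv b bv.
  have Hb : H (phi b) by rewrite -same_gen; apply: gen_elt; exact: map_f.
  have : (0 < class_count H (phi b) (map phi v))%N.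
    rewrite -has_count; apply/hasP; exists (phi b); first exact: map_f.
    by apply/asboolP; exists 1; [exact: gen_one | rewrite invr1 mul1r mulr1].
  rewrite -same_count // -has_count => /hasP [_ /mapP [a aw ->] /asboolP hc].
  have /andP [_ aD] := allP okW a aw.
  have [c [e rc cD _]] := conj_in_lab (allP rw a aw) aD (conj_in_sym unit_w hc).
  by rewrite (phi_inj rb rc e) cD andbT; case/and3P: rc.
split=> //; apply/allP => l; rewrite -map_cat => /mapP [a awv ->].
have [ra aD Ha] : [/\ refl_letter a, a.2 \in D & H (phi a)].
  move: awv; rewrite mem_cat => /orP [h|h].
    split; [exact: allP rw a h | by case/andP: (allP okW a h) | ].
    by apply: gen_elt; exact: map_f.
  split; [exact: allP rv a h | by case/andP: (allP okV a h) | ].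
  by rewrite -same_gen; apply: gen_elt; exact: map_f.
rewrite /= !count_map; apply/eqP.
by rewrite -(class_countE rw okW ra aD) -(class_countE rv okV ra aD) same_count.
Qed.

End ClassCounts.

(** * The three families *)

Definition tail_pair (pr : rel nat) (s : seq nat) : bool := has_pair pr (behead s).

Section Cores.
Context (D : seq nat) (tau : nat -> nat) (pr : rel nat).
Context (okD : class_ok D tau) (okpr : pair_ok D pr).

(** Relatedness is visible in the types. This holds for [axis] with [noncomm] and [unit_type] with
    [mixed], but not for order-3 letters with [noncomm]: two of one type commute exactly when
    equal. *)
Definition pair_label_ok : bool :=
  all (fun x => all (fun y => all (fun x' => if tau x == tau x' then
    all (fun y' => if tau y == tau y' then pr x y == pr x' y' else true) D else true) D) D) D.

Lemma has_pair_label s t : pair_label_ok -> {subset s <= D} -> {subset t <= D} ->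
  map tau s =i map tau t -> has_pair pr s -> has_pair pr t.
Proof.
move=> hl sD tD e /has_pairP [x [y [xs ys h]]].
have /mapP [x' xt ex] : tau x \in map tau t by rewrite -e map_f.
have /mapP [y' yt ey] : tau y \in map tau t by rewrite -e map_f.
have := allP (allP (allP hl x (sD _ xs)) y (sD _ ys)) x' (tD _ xt).
rewrite -ex eqxx => /allP /(_ _ (tD _ yt)); rewrite -ey eqxx h => /eqP e'.
by apply/has_pairP; exists x', y'.
Qed.

Lemma lab_tau (w v : seq (algC * nat)) : map (lab tau) w = map (lab tau) v ->
  map tau (unzip2 w) = map tau (unzip2 v).
Proof. by move/(congr1 (map snd)); rewrite -!map_comp. Qed.

(** The good word [v] has the types of [w], so [w] contains a related pair too, which is pulled to
    its front. *)
Lemma tail_core a w v : pair_label_ok -> okw D (a :: w) -> has_pair pr (unzip2 (a :: w)) ->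
  okw D v -> good pr (unzip2 v) -> map (lab tau) w = map (lab tau) v -> (3 <= size (a :: w))%N ->
  exists2 w', word_equiv w w' & tail_pair pr (take 3 (unzip2 (a :: w'))).
Proof.
move=> hl /andP [_ okW] _ okV gv e /= sz.
have szv : size v = size w by rewrite -(size_map (lab tau)) -e size_map.
rewrite pair_good ?szv // in gv.
have hw : has_pair pr (unzip2 w).
  by apply: has_pair_label gv => //; [exact: okw_D | exact: okw_D | rewrite (lab_tau e)].
have [b [c [u [eu h]]]] := pair_front okD okpr okW hw.
exists (b :: c :: u) => //; rewrite /tail_pair /= take0.
by apply/has_pairP; exists b.2, c.2; rewrite !inE !eqxx orbT.
Qed.

(** Either [w] has a related pair, brought to its front, or every pair uses [a], and a partner of
    [a] is pulled next to it. *)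
Lemma plain_core a w (v : seq (algC * nat)) : okw D (a :: w) -> has_pair pr (unzip2 (a :: w)) ->
  okw D v -> good pr (unzip2 v) -> map (lab tau) w = map (lab tau) v -> (5 <= size (a :: w))%N ->
  exists2 w', word_equiv w w' & has_pair pr (take 5 (unzip2 (a :: w'))).
Proof.
move=> ok hp _ _ _ _; have /andP [/andP [_ aD] okW] := ok.
have [hw|hw] := boolP (has_pair pr (unzip2 w)).
  have [b [c [u [eu h]]]] := pair_front okD okpr okW hw.
  exists (b :: c :: u) => //; apply/has_pairP; exists b.2, c.2.
  by rewrite /= !inE !eqxx !orbT.
have [y yw h] : exists2 y, y \in unzip2 w & pr a.2 y.
  case/has_pairP: hp => x [y [xs ys h]]; have sD := okw_D ok.
  have [h' _ _] := pr_spec okpr (sD _ xs) (sD _ ys) aD h.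
  move: (xs) (ys); rewrite [unzip2 _]/= !inE => /orP [/eqP ex|xw] /orP [/eqP ey|yw].
  - by rewrite ex ey (pr_irr okpr) in h.
  - by exists y; rewrite // -ex.
  - by exists x; rewrite // -ey.
  - by case/negP: hw; apply/has_pairP; exists x, y.
case/mapP: yw h => b bw -> h; case/splitPr: bw => w1 w2.
exists (b :: map (conjl^~ b) w1 ++ w2); first exact: pull_equiv.
by apply/has_pairP; exists a.2, b.2; rewrite /= !inE !eqxx !orbT.
Qed.

End Cores.

(** * Finite checks for the three families *)

Lemma axis_short k : (1 < k < 3)%N -> short_check (iota 0 6) noncomm axis k.
Proof. by case: k => [|[|[|k]]] h; first [discriminate h | vm_compute]. Qed.

Lemma axis_long : long_check (iota 0 6) noncomm axis (tail_pair noncomm) 3.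
Proof. by vm_compute. Qed.

Lemma mixed_short k : (1 < k < 3)%N -> short_check (iota 0 14) mixed unit_type k.
Proof. by case: k => [|[|[|k]]] h; first [discriminate h | vm_compute]. Qed.

Lemma mixed_long : long_check (iota 0 14) mixed unit_type (tail_pair mixed) 3.
Proof. by vm_compute. Qed.

Lemma order3_short k : (1 < k < 5)%N -> short_check (iota 6 8) noncomm unit_type k.
Proof. by case: k => [|[|[|[|[|k]]]]] h; first [discriminate h | vm_compute]. Qed.

Lemma order3_long : long_check (iota 6 8) noncomm unit_type (has_pair noncomm) 5.
Proof. by vm_compute. Qed.

Lemma axis_class : class_ok (iota 0 6) axis. Proof. by vm_compute. Qed.
Lemma axis_pair : pair_ok (iota 0 6) noncomm. Proof. by vm_compute. Qed.
Lemma axis_label : pair_label_ok (iota 0 6) axis noncomm. Proof. by vm_compute. Qed.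
Lemma axis_trans : trans_ok (iota 0 6) axis noncomm. Proof. by vm_compute. Qed.
Lemma mixed_class : class_ok (iota 0 14) unit_type. Proof. by vm_compute. Qed.
Lemma mixed_pair : pair_ok (iota 0 14) mixed. Proof. by vm_compute. Qed.
Lemma mixed_label : pair_label_ok (iota 0 14) unit_type mixed. Proof. by vm_compute. Qed.
Lemma mixed_trans : trans_ok (iota 0 14) unit_type mixed. Proof. by vm_compute. Qed.
Lemma order3_class : class_ok (iota 6 8) unit_type. Proof. by vm_compute. Qed.
Lemma order3_pair : pair_ok (iota 6 8) noncomm. Proof. by vm_compute. Qed.
Lemma order3_trans : trans_ok (iota 6 8) unit_type noncomm. Proof. by vm_compute. Qed.

Lemma in_gen_comm (S : seq M2) x y : {in S, forall x, x \is a GRing.unit} ->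
  {in S &, forall x y, GRing.comm x y} -> in_gen S x -> in_gen S y -> GRing.comm x y.
Proof.
move=> u c gx gy.
have h z : z \in S -> GRing.comm z y.
  move=> zS; elim: gy => [|t tS|t1 t2 _ h1 _ h2|t _ ht]; first exact: commr1.
  - exact: c.
  - exact: commrM.
  - exact: commrV.
elim: gx => [|t /h //|t1 t2 _ h1 _ h2|t _ ht]; apply: commr_sym; first exact: commr1.
- by apply: commrM; exact: commr_sym.
- by apply: commrV; exact: commr_sym.
Qed.

Lemma noncommP a b : refl_letter a -> refl_letter b ->
  reflect (~ GRing.comm (phi a) (phi b)) (noncomm a.2 b.2).
Proof.
move=> ra rb; have ha := refl_letter_lt24 ra; have hb := refl_letter_lt24 rb.
have a0 : a.1 != 0 by case/and3P: ra.
have b0 : b.1 != 0 by case/and3P: rb.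
have ub := phi_unit b0 hb.
apply: (iffP negP) => h c; apply: h; last first.
  move/eqP: c => c; rewrite /GRing.comm.
  have -> : phi a * phi b = phi b * ((phi b)^-1 * phi a * phi b) by rewrite !mulrA mulrV // mul1r.
  by rewrite -phi_conj // /conjl c; case: (a).
apply/eqP; apply: (phi_inj_label a0 _ ha); first exact: conji_lt.
rewrite -[LHS]/(phi (conjl a b)) phi_conj // -mulrA c mulKr //; by case: (a).
Qed.

Theorem theorem1p2 (n : nat) (T V : seq 'M[algC]_2) :
  refl_fact_G7 n T -> refl_fact_G7 n V ->
  (hurwitz_equiv T V <->
   [/\ refl_prod T = refl_prod V,
       (forall x, in_gen T x <-> in_gen V x) &
       (forall x, in_gen T x -> class_count (in_gen T) x T = class_count (in_gen T) x V)]).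
Proof.
move=> fT fV; have [w eT rw] := reflection_word fT; have [v eV rv] := reflection_word fV.
have uw := refl_letter_unit rw; have uv := refl_letter_unit rv.
have G7w x : x \in map phi w -> G7 x by rewrite -eT; case: fT => _ h /h [].
rewrite eT eV; split=> [/(hurwitz_equiv_inv uw) [_ -> -> h] | [ep eg ec]]; first by split.
have {}eg : in_gen (map phi v) = in_gen (map phi w).
  by apply/funext => x; apply/propext; rewrite -eg.
have okall (D : seq nat) u : all refl_letter u -> {subset unzip2 u <= D} -> okw D u.
  move=> /allP ru uD; apply/allP => a au; apply/andP; split; first by case/and3P: (ru a au).
  by apply: uD; exact: (map_f snd).
suff : word_equiv w v.
  apply: hurwitz_equiv_phi; apply: sub_all rw => a ra.
  by rewrite refl_letter_lt24 // andbT; case/and3P: ra.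
have [hmix|nmix] := boolP (has_pair mixed (unzip2 w)).
  have ok14 u : all refl_letter u -> okw (iota 0 14) u.
    move=> ru; apply: okall => // _ /mapP [a au ->]; rewrite mem_iota.
    by case/and3P: (allP ru a au).
  have [okV p] := same_labels mixed_class rw rv (ok14 _ rw) G7w
    (fun a b => trans_conj_in mixed_class mixed_trans (ok14 _ rw) hmix) eg ec.
  apply: (word_equiv_of_labels mixed_class mixed_pair (isT : 3 <= 3)%N mixed_short mixed_long
    _ (ok14 _ rw) okV _ _ p ep).
  - by move=> a x y; apply: tail_core mixed_class mixed_pair _ _ _ mixed_label.
  - by rewrite goodE hmix orbT.
  - rewrite goodE; apply/orP; right.
    apply: (has_pair_label mixed_label _ _ _ hmix).
    + exact: okw_D (ok14 _ rw).
    + exact: okw_D okV.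
    + by move=> i; have := perm_mem (perm_map snd p) i; rewrite -!map_comp.
have [hnc|nnc] := boolP (has_pair noncomm (unzip2 w)); last first.
  (* Abelian case: moves only permute the letters and conjugation fixes each of them, so every
     letter serves as its own type. *)
  pose D := unzip2 w.
  have cD x y : x \in D -> y \in D -> conji x y = x.
    move=> xD yD; apply/eqP; apply: contraNT nnc => h.
    by apply/has_pairP; exists x, y; split=> //.
  have okD : class_ok D id.
    apply/allP => x xD; apply/andP; split.
      by case/mapP: (xD) => a aw ->; case/and3P: (allP rw a aw).
    by apply/allP => y yD; rewrite cD // xD eqxx.
  have okW : okw D w by apply: okall.
  have [|okV p] := same_labels okD rw rv okW G7w _ eg ec.
    move=> a b _ _ [e1 e2]; have -> : b = a by case: (a) (b) e1 e2 => [? ?] [? ?] /= -> ->.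
    by exists 1; [exact: gen_one | rewrite invr1 mul1r mulr1].
  have [v' e' l'] := word_rearrange okD okW p.
  suff <- : v' = v by [].
  apply: inj_map l' => -[x i] [y j]; by [].
(* Noncommutation passes from [w] to [v] through the common group: if the letters of [v] commuted,
   that group would be abelian. *)
have transfer : has_pair noncomm (unzip2 v).
  apply: contraTT hnc => hv; apply/negP => /has_pairP [_ [_ [/mapP [a aw ->] /mapP [b bw ->] h]]].
  have ra := allP rw a aw; have rb := allP rw b bw.
  move/(noncommP ra rb): h; apply.
  apply: (@in_gen_comm (map phi v)) => //; try by rewrite eg; apply: gen_elt; exact: map_f.
  move=> _ _ /mapP [c cv ->] /mapP [d dv ->]; apply: contrapT => hcd.
  case/negP: hv; apply/has_pairP; exists c.2, d.2; split; try exact: (map_f snd).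
  by apply/noncommP => //; [exact: allP rv c cv | exact: allP rv d dv].
have gw : good noncomm (unzip2 w) by rewrite goodE hnc orbT.
have gv : good noncomm (unzip2 v) by rewrite goodE transfer orbT.
have [x0 x0w] : exists x0, x0 \in unzip2 w by case/has_pairP: hnc => x [_ [? _ _]]; exists x.
(* Without a mixed pair, the quaternion parts all have order 4 or all have order 3, and [x0] decides
   which. *)
have same x : x \in unzip2 w -> (x < 6)%N = (x0 < 6)%N.
  move=> xw; apply: contraNeq nmix => h; apply/has_pairP; exists x, x0; split=> //.
  by move: h; rewrite /mixed; case: (x < 6)%N; case: (x0 < 6)%N.
have lt14 x : x \in unzip2 w -> (x < 14)%N by case/mapP=> a aw ->; case/and3P: (allP rw a aw).
have [h6|h6] := boolP (x0 < 6)%N.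
  have okW : okw (iota 0 6) w by apply: okall => // x xw; rewrite mem_iota same.
  have [okV p] := same_labels axis_class rw rv okW G7w
    (fun a b => trans_conj_in axis_class axis_trans okW hnc) eg ec.
  apply: (word_equiv_of_labels axis_class axis_pair (isT : 3 <= 3)%N axis_short axis_long
    _ okW okV gw gv p ep).
  by move=> a x y; apply: tail_core axis_class axis_pair _ _ _ axis_label.
have okW : okw (iota 6 8) w.
  by apply: okall => // x xw; rewrite mem_iota leqNgt same // h6 lt14.
have [okV p] := same_labels order3_class rw rv okW G7w
  (fun a b => trans_conj_in order3_class order3_trans okW hnc) eg ec.
apply: (word_equiv_of_labels order3_class order3_pair (isT : 3 <= 5)%N order3_short order3_long
  _ okW okV gw gv p ep).
by move=> a x y; apply: plain_core order3_class order3_pair _ _ _.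
Qed.
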